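(* Assume that $y_3,\,y_1-y_3,\,y_2-y_3\notin\mathbb Zv$, and set $Y_1:=3\lfloor\frac{y_1-y_3}{v}\rfloor$, $Y_2:=3\lfloor\frac{y_2-y_3}{v}\rfloor$, $Y_3:=3\lfloor\frac{y_3}{v}\rfloor$. Then $$g_4(\boldsymbol z;\tau)=i\,q^{\frac13(Y_1Y_2+Y_1Y_3+Y_2Y_3)+\frac{Y_3^2}{6}+\frac{Y_3}{2}-\frac38}\,\zeta_1^{-Y_2-Y_3}\zeta_2^{-Y_1-Y_3}\zeta_3^{Y_3-\frac32}$$ $$\times F^*\left(3(z_1+z_2-z_3)-(Y_1+Y_2+Y_3)\tau-\tfrac{3\tau}2+\tfrac12,\ 3z_1-(Y_1+Y_3)\tau,\ 3z_2-(Y_2+Y_3)\tau;\ 3\tau\right).$$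
   Context: Notation: $\tau=u+iv\in\mathbb H$, $\boldsymbol z=\boldsymbol x+i\boldsymbol y\in\mathbb C^3$, $q:=e^{2\pi i\tau}$, $\zeta_j:=e^{2\pi i z_j}$, with rational powers $q^s:=e^{2\pi i s\tau}$, $\zeta_j^s:=e^{2\pi i sz_j}$; $\mathbb N=\{1,2,\dots\}$, $\mathbb N_0=\mathbb N\cup\{0\}$. Let $S_1:=\{\boldsymbol x\in\mathbb R^3:x_1,x_2\ge x_3\ge0\}$ and $S_3:=\{\boldsymbol x\in\mathbb R^3:x_1,x_2>x_3>0\}$, and $$g_4(\boldsymbol z;\tau):=\left(\sum_{\substack{\boldsymbol n\in\mathbb Z^3\\ \boldsymbol n+\frac{\boldsymbol y}{v}\in S_1}}+\sum_{\substack{\boldsymbol n\in\mathbb Z^3\\ \boldsymbol n+\frac{\boldsymbol y}{v}\in-S_3}}\right)q^{3n_1n_2-\frac{3n_3^2}2}\zeta_1^{3n_2}\zeta_2^{3n_1}\zeta_3^{-3n_3}.$$ Further, $$F^*(\boldsymbol z;\tau):=q^{-\frac18}\zeta_1^{-\frac12}\zeta_2^{\frac12}\zeta_3^{\frac12}\left(\sum_{\boldsymbol n\in\mathbb N_0^3}+\sum_{\boldsymbol n\in-\mathbb N^3}\right)(-1)^{n_1}q^{\frac{n_1(n_1+1)}2+n_1n_2+n_1n_3+n_2n_3}\zeta_1^{n_1}\zeta_2^{n_2}\zeta_3^{n_3}.$$ *)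

(* Defs.v *)
From mathcomp Require Import all_boot all_order all_algebra.
From mathcomp Require Import all_classical all_reals all_analysis.
From mathcomp Require Import complex.
From mathcomp.analysis.showcase Require Import summability.

Set Implicit Arguments.
Unset Strict Implicit.
Unset Printing Implicit Defensive.

Import Order.TTheory GRing.Theory Num.Theory.
Import numFieldNormedType.Exports.
Local Open Scope classical_set_scope.
Local Open Scope complex_scope.
Local Open Scope ring_scope.

Definition Z3 : Type := (int * int * int)%type.

(* The summand f, restricted to A, as a map into R[i]^o: the regular module
   is what carries the normed-module structure needed by `partial_sum`. *)
Definition on_set (R : realType) (A : set Z3) (f : Z3 -> R[i]) : Z3 -> R[i]^o :=
  fun n => if n \in A then f n else 0.

(* Unordered summation, as the limit of the finite partial sums along the
   directed set of finite subsets of Z^3.  As `lim` is total, `sum_on A f` is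
   meaningful only together with `summable_on A f`. *)
Definition summable_on (R : realType) (A : set Z3) (f : Z3 -> R[i]) : Prop :=
  cvg (partial_sum (on_set A f) @ totally).

Definition sum_on (R : realType) (A : set Z3) (f : Z3 -> R[i]) : R[i] :=
  summability.sum (on_set A f).

Definition cexp (R : realType) (w : R[i]) : R[i] :=
  (expR (complex.Re w))%:C
  * (cos (complex.Im w) +i* sin (complex.Im w)).

(* e^{2 pi i s w} for real s: this is q^s when w = tau, and zeta_j^s when
   w = z_j. *)
Definition epow (R : realType) (w : R[i]) (s : R) : R[i] :=
  cexp ((2 * pi * s)%:C * 'i%C * w).

Definition S1 (R : realType) : set (R * R * R) :=
  [set x | let: (x1, x2, x3) := x in [/\ x3 <= x1, x3 <= x2 & 0 <= x3]].

Definition S3 (R : realType) : set (R * R * R) :=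
  [set x | let: (x1, x2, x3) := x in [/\ x3 < x1, x3 < x2 & 0 < x3]].

Definition oppS3 (R : realType) : set (R * R * R) :=
  [set (- x.1.1, - x.1.2, - x.2) | x in @S3 R].

(* n + y/v, where y = Im z and v = Im tau *)
Definition shifted (R : realType) (z1 z2 z3 tau : R[i]) (n : Z3) : R * R * R :=
  let: (n1, n2, n3) := n in
  (n1%:~R + complex.Im z1 / complex.Im tau,
   n2%:~R + complex.Im z2 / complex.Im tau,
   n3%:~R + complex.Im z3 / complex.Im tau).

Definition g4_term (R : realType) (z1 z2 z3 tau : R[i]) (n : Z3) : R[i] :=
  let: (n1, n2, n3) := n in
  epow tau (3 * n1%:~R * n2%:~R - 3 * n3%:~R ^+ 2 / 2)
  * epow z1 (3 * n2%:~R) * epow z2 (3 * n1%:~R) * epow z3 (- 3 * n3%:~R).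

Definition g4_pos (R : realType) (z1 z2 z3 tau : R[i]) : set Z3 :=
  [set n | @S1 R (shifted z1 z2 z3 tau n)].

Definition g4_neg (R : realType) (z1 z2 z3 tau : R[i]) : set Z3 :=
  [set n | @oppS3 R (shifted z1 z2 z3 tau n)].

Definition g4 (R : realType) (z1 z2 z3 tau : R[i]) : R[i] :=
  sum_on (g4_pos z1 z2 z3 tau) (g4_term z1 z2 z3 tau)
  + sum_on (g4_neg z1 z2 z3 tau) (g4_term z1 z2 z3 tau).

Definition g4_summable (R : realType) (z1 z2 z3 tau : R[i]) : Prop :=
  summable_on (g4_pos z1 z2 z3 tau) (g4_term z1 z2 z3 tau)
  /\ summable_on (g4_neg z1 z2 z3 tau) (g4_term z1 z2 z3 tau).

(* N_0^3 and -N^3 (with N = {1, 2, ...}) inside Z^3 *)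
Definition octant_nonneg : set Z3 :=
  [set n | let: (n1, n2, n3) := n in [/\ 0 <= n1, 0 <= n2 & 0 <= n3]].

Definition octant_neg : set Z3 :=
  [set n | let: (n1, n2, n3) := n in [/\ n1 < 0, n2 < 0 & n3 < 0]].

Definition Fstar_term (R : realType) (z1 z2 z3 tau : R[i]) (n : Z3) : R[i] :=
  let: (n1, n2, n3) := n in
  (-1) ^ n1
  * epow tau (n1%:~R * (n1%:~R + 1) / 2 + n1%:~R * n2%:~R + n1%:~R * n3%:~R
              + n2%:~R * n3%:~R)
  * epow z1 n1%:~R * epow z2 n2%:~R * epow z3 n3%:~R.

Definition Fstar (R : realType) (z1 z2 z3 tau : R[i]) : R[i] :=
  epow tau (- 8^-1) * epow z1 (- 2^-1) * epow z2 2^-1 * epow z3 2^-1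
  * (sum_on octant_nonneg (Fstar_term z1 z2 z3 tau)
     + sum_on octant_neg (Fstar_term z1 z2 z3 tau)).

Definition Fstar_summable (R : realType) (z1 z2 z3 tau : R[i]) : Prop :=
  summable_on octant_nonneg (Fstar_term z1 z2 z3 tau)
  /\ summable_on octant_neg (Fstar_term z1 z2 z3 tau).

(* x \in Z v *)
Definition in_Zmul (R : realType) (v x : R) : Prop := exists k : int, x = k%:~R * v.

(* Main.v *)
(* Put a, b, c for the floors of (y1 - y3)/v, (y2 - y3)/v, y3/v.  As the
   fractional parts are nonzero, the unimodular substitution
   m = (n3 + c, n2 - n3 + b, n1 - n3 + a) carries the two cones of g_4 exactly
   onto N_0^3 and -N^3, and the summands of the two series then agree term by
   term up to one constant.  In the coordinates x = n + y/v the modulus of a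
   summand is a constant times exp(-6 pi v (x1 x2 - x3^2/2)); with t = x3,
   s1 = x1 - x3, s2 = x2 - x3 this form is t^2/2 + t (s1 + s2) + s1 s2, where
   t, s1, s2 have the same sign and stay at a distance d > 0 from 0, so it is
   at least d/2 (|t| + |s1| + |s2|) and the series is dominated by a product of
   geometric series. *)

Require Import Defs.
From mathcomp Require Import all_boot all_order all_algebra finmap.
From mathcomp Require Import all_classical all_reals all_analysis.
From mathcomp Require Import complex ring lra.
From mathcomp.analysis.showcase Require Import summability.
Import Order.TTheory GRing.Theory Num.Theory.
Import numFieldNormedType.Exports.
Local Open Scope classical_set_scope.
Local Open Scope complex_scope.
Local Open Scope ring_scope.

#[local] Existing Instance totally_filter.

(** * Unordered sums: convergence, reindexing, products and geometric bounds *)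

Lemma ler_sum_uniq_sub (R : numDomainType) (I : eqType) (g : I -> R)
    (s t : seq I) : (forall i, 0 <= g i) -> uniq s -> {subset s <= t} ->
  \sum_(i <- s) g i <= \sum_(i <- t) g i.
Proof.
move=> g0; elim: s t => [|x s IHs] t /=.
  by move=> _ _; rewrite big_nil; apply: sumr_ge0.
move=> /andP[xs us] st; have xt : x \in t by apply: st; rewrite mem_head.
rewrite big_cons (big_rem x xt) /= lerD2l; apply: IHs => // y ys.
have := st y; rewrite inE ys orbT => /(_ isT).
rewrite (perm_mem (perm_to_rem xt)) inE => /orP[/eqP yx|//].
by move: xs; rewrite -yx ys.
Qed.

Lemma partial_sumE (I : choiceType) (V : zmodType) (x : I -> V) (A : {fset I}) :
  partial_sum x A = \sum_(i <- A) x i.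
Proof. by rewrite /partial_sum big_seq_fsetE. Qed.

(** Partial sums grow with the finite set, so the net converges to the supremum of its bounded
    range. *)
Lemma ge0_partial_sum_cvg (R : realType) (I : choiceType) (g : I -> R) (M : R) :
  (forall i, 0 <= g i) -> (forall A, partial_sum g A <= M) ->
  cvg (partial_sum g @ totally).
Proof.
move=> g0 gM; pose E : set R := range (partial_sum g).
have ubE : has_ubound E by exists M => _ [A _ <-].
have supE : has_sup E.
  by split => //; exists (partial_sum g fset0); exists fset0.
apply/cvg_ex; exists (sup E); apply/cvgrPdist_le => e e0.
have [_ [A _ <-] eA] := sup_adherent e0 supE.
exists A => // B /= AB.
have BE : partial_sum g B <= sup E by apply: ub_le_sup => //; exists B.
have AB' : partial_sum g A <= partial_sum g B.
  rewrite !partial_sumE; apply: ler_sum_uniq_sub => //.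
  exact/fsubsetP.
rewrite ger0_norm ?subr_ge0// lerBlDr -lerBlDl.
by apply: le_trans AB'; apply: ltW.
Qed.

(** Writing [f] as [(f + g) - g] leaves two nonnegative families, with partial sums bounded by
    [M + M] and [M]. *)
Lemma dominated_partial_sum_cvg (R : realType) (I : choiceType) (f g : I -> R)
    (M : R) :
  (forall i, `|f i| <= g i) -> (forall A, partial_sum g A <= M) ->
  cvg (partial_sum f @ totally).
Proof.
move=> fg gM.
have -> : partial_sum f = partial_sum (fun i => f i + g i) \- partial_sum g.
  apply/funext => A; rewrite /GRing.sub_fun /= !partial_sumE -sumrB.
  by apply: eq_bigr => i _; rewrite addrK.
apply: is_cvgB; last first.
  by apply: (@ge0_partial_sum_cvg _ _ _ M) => // i; exact: le_trans (fg i).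
apply: (@ge0_partial_sum_cvg _ _ _ (M + M)) => [i|A].
  by have := fg i; rewrite ler_norml => /andP[+ _]; rewrite -subr_ge0 opprK.
rewrite partial_sumE big_split /= -!partial_sumE; apply: lerD => //.
apply: le_trans (gM A); rewrite !partial_sumE; apply: ler_sum => i _.
exact: le_trans (ler_norm _) (fg i).
Qed.

Lemma complex_norm_le (R : rcfType) (z : R[i]) :
  `|z| <= (`|complex.Re z| + `|complex.Im z|)%:C.
Proof.
rewrite normc_def lecR -(ger0_norm (addr_ge0 (normr_ge0 _) (normr_ge0 _))).
rewrite -sqrtr_sqr ler_wsqrtr// sqrrD !real_normK ?num_real//.
by rewrite addrAC lerDl mulrn_wge0// mulr_ge0.
Qed.

Lemma complex_cvg (R : realType) (T : Type) (F : set_system T) {FF : Filter F}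
    (f : T -> R[i]^o) :
  cvg ((fun t => complex.Re (f t)) @ F) ->
  cvg ((fun t => complex.Im (f t)) @ F) -> cvg (f @ F).
Proof.
move=> /cvg_ex[a fa] /cvg_ex[b fb]; apply/cvg_ex; exists (a +i* b : R[i]^o).
(* A positive element of [R[i]] has zero imaginary part, so [e] is a positive real and can be halved
   between the two coordinates. *)
apply/cvgrPdist_le => e; rewrite ltcE /= => /andP[/eqP e0 e1].
have -> : e = (complex.Re e / 2 + complex.Re e / 2)%:C.
  by case: e e0 e1 => x y /= -> _; rewrite -splitr.
have e2 : 0 < complex.Re e / 2 by rewrite divr_gt0.
move/cvgrPdist_le: fa => /(_ _ e2) fa; move/cvgrPdist_le: fb => /(_ _ e2) fb.
near=> t; apply: le_trans (complex_norm_le _ _) _; rewrite lecR.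
have -> : complex.Re (a +i* b - f t) = a - complex.Re (f t) by case: (f t).
have -> : complex.Im (a +i* b - f t) = b - complex.Im (f t) by case: (f t).
by apply: lerD; near: t.
Unshelve. all: by end_near. Qed.

Lemma complex_dominated_partial_sum_cvg (R : realType) (I : choiceType)
    (f : I -> R[i]^o) (g : I -> R) (M : R) :
  (forall i, `|f i| <= (g i)%:C) -> (forall A, partial_sum g A <= M) ->
  cvg (partial_sum f @ totally).
Proof.
move=> fg gM.
have normI (z : R[i]) : `|complex.Im z|%:C <= `|z|.
  rewrite normc_def lecR -sqrtr_sqr ler_wsqrtr// lerDr; exact: sqr_ge0.
have ReS A : complex.Re (partial_sum f A) =
    partial_sum (fun i => complex.Re (f i)) A.
  rewrite !partial_sumE.
  exact: (big_morph _ (fun x y => raddfD (@complex.Re R) x y)).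
have ImS A : complex.Im (partial_sum f A) =
    partial_sum (fun i => complex.Im (f i)) A.
  rewrite !partial_sumE.
  exact: (big_morph _ (fun x y => raddfD (@complex.Im R) x y)).
apply: complex_cvg.
- rewrite (_ : (fun _ => _) = partial_sum (fun i => complex.Re (f i)));
    last exact/funext.
  apply: (@dominated_partial_sum_cvg _ _ _ g M) => // i.
  by rewrite -lecR; apply: le_trans (fg i); exact: normc_ge_Re.
- rewrite (_ : (fun _ => _) = partial_sum (fun i => complex.Im (f i)));
    last exact/funext.
  apply: (@dominated_partial_sum_cvg _ _ _ g M) => // i.
  by rewrite -lecR; apply: le_trans (fg i); exact: normI.
Qed.

(** A bijection induces an inclusion-preserving bijection of finite subsets, so a threshold [A] for
    [f] pulls back to the threshold [psi(A)]. *)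
Lemma partial_sum_reindex_cvg (R : numFieldType) (I J : choiceType)
    (f : I -> R^o) (phi : J -> I) (psi : I -> J) (c l : R^o) :
  cancel phi psi -> cancel psi phi ->
  (partial_sum f @ totally --> l)%classic ->
  (partial_sum (fun j => c * f (phi j) : R^o) @ totally -->
    (c * l : R^o))%classic.
Proof.
move=> phiK psiK fl.
have -> : partial_sum (fun j => c * f (phi j) : R^o) =
    (fun A : {fset J} => c *: partial_sum f (imfset imfset_key phi (mem A))).
  apply/funext => A; rewrite !partial_sumE big_imfset/=; last first.
    by move=> x y _ _; exact: (can_inj phiK).
  by rewrite scaler_sumr.
apply: cvgZr; move=> U /fl[A _ AU].
exists (imfset imfset_key psi (mem A)) => // B /= AB; apply: AU => /=.
apply/fsubsetP => i iA; apply/imfsetP; exists (psi i) => //=.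
by apply: (fsubsetP AB); apply/imfsetP; exists i.
Qed.

Lemma sum_on_reindex (R : realType) (A B : set Z3) (f g : Z3 -> R[i])
    (phi psi : Z3 -> Z3) (c : R[i]) :
  cancel phi psi -> cancel psi phi ->
  (forall n, A n <-> B (phi n)) -> (forall n, g n = c * f (phi n)) ->
  summable_on B f -> summable_on A g /\ sum_on A g = c * sum_on B f.
Proof.
move=> phiK psiK AB gf Bf.
have := @partial_sum_reindex_cvg _ _ _ _ _ _ c _ phiK psiK Bf.
have <- : on_set A g = (fun n => c * on_set B f (phi n)).
  apply/funext => n; rewrite /on_set gf.
  have -> : (n \in A) = (phi n \in B).
    by apply/idP/idP => /set_mem /AB ?; apply/mem_set => //; apply/AB.
  by case: ifP; rewrite ?mulr0.
move=> h; split; first by apply/cvg_ex; eexists; exact: h.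
rewrite /sum_on /summability.sum; apply: (cvg_lim _ h); exact: norm_hausdorff.
Qed.

(** A finite set of pairs lies in the rectangle of its two projections, over which the sum
    factors. *)
Lemma partial_sum_prod_le (R : realType) (I J : choiceType) (g : I -> R)
    (h : J -> R) (M N : R) :
  (forall i, 0 <= g i) -> (forall j, 0 <= h j) ->
  (forall A, partial_sum g A <= M) -> (forall A, partial_sum h A <= N) ->
  forall A, partial_sum (fun p : I * J => g p.1 * h p.2) A <= M * N.
Proof.
move=> g0 h0 gM hN A; rewrite partial_sumE.
pose A1 := imfset imfset_key fst (mem A).
pose A2 := imfset imfset_key snd (mem A).
apply: (@le_trans _ _
  (\sum_(p <- [seq (i, j) | i <- A1, j <- A2]) g p.1 * h p.2)).
  apply: ler_sum_uniq_sub; [by move=> p; exact: mulr_ge0|exact: fset_uniq|].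
  move=> [i j] ijA; apply/allpairsP; exists (i, j); split=> //=; apply/imfsetP.
    by exists (i, j).
  by exists (i, j).
rewrite big_allpairs_dep /=.
under eq_bigr do rewrite -mulr_sumr.
rewrite -mulr_suml; apply: ler_pM; rewrite ?sumr_ge0 -?partial_sumE//.
Qed.

Lemma partial_sum_geometric_int_le (R : realType) (r : R) : 0 < r < 1 ->
  exists M, forall A : {fset int},
    partial_sum (fun n : int => r ^+ `|n|%N) A <= M.
Proof.
move=> /andP[r0 r1]; exists ((1 - r)^-1 + (1 - r)^-1) => A.
rewrite partial_sumE.
have geo N : \sum_(n <- iota 0 N) r ^+ n <= (1 - r)^-1.
  rewrite -{1}[N]subn0 -/(index_iota 0 N) big_mkord.
  rewrite -[_^-1]mul1r ler_pdivlMr ?subr_gt0// mulrC -opprB mulNr -subrX1.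
  by rewrite opprB gerBl exprn_ge0// ltW.
pose N := (\max_(n <- A) `|n|).+1%N.
have NA n : n \in (A : seq int) -> (`|n| < N)%N.
  move=> nA; rewrite ltnS.
  exact: (@leq_bigmax_seq _ _ xpredT (fun n : int => `|n|%N)) nA isT.
(* [A] lies in {-N, ..., N-1}. As [Negz n] is -(n+1), the negative half contributes r^(n+1) <= r^n,
   so each half is at most (1-r)^-1. *)
apply: (@le_trans _ _
  (\sum_(n <- [seq Posz n | n <- iota 0 N] ++ [seq Negz n | n <- iota 0 N])
     r ^+ `|n|%N)).
  apply: ler_sum_uniq_sub;
    [by move=> n; rewrite exprn_ge0// ltW|exact: fset_uniq|].
  move=> n /NA nN; rewrite mem_cat; apply/orP; case: n nN => n nN.
    by left; apply: map_f; rewrite mem_iota.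
  by right; apply: map_f; rewrite mem_iota; exact: ltnW.
rewrite big_cat !big_map; apply: lerD => //.
apply: le_trans (geo N); apply: ler_sum => n _.
by rewrite -[absz _]/n.+1 exprS ler_piMl ?exprn_ge0// ltW.
Qed.

(** * The complex exponential and its modulus *)

Lemma cexpD (R : realType) (x y : R[i]) : cexp (x + y) = cexp x * cexp y.
Proof.
case: x y => [a b] [c d]; rewrite /cexp /= expRD cosD sinD.
by apply/eqP; rewrite eq_complex /=; apply/andP; split; apply/eqP; ring.
Qed.

Lemma cexp0 (R : realType) : cexp (0 : R[i]) = 1.
Proof. by rewrite /cexp /= expR0 cos0 sin0 mul1r. Qed.

Lemma cexp_neq0 (R : realType) (x : R[i]) : cexp x != 0.
Proof.
apply/eqP => x0; have /eqP := cexpD _ x (- x).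
by rewrite subrr cexp0 x0 mul0r oner_eq0.
Qed.

Lemma cexpMz (R : realType) (x : R[i]) (m : int) :
  cexp (x * m%:~R) = cexp x ^ m.
Proof.
have cn n : cexp (x * n%:R) = cexp x ^+ n.
  elim: n => [|n IHn]; first by rewrite mulr0 cexp0.
  by rewrite -addn1 natrD mulrDr mulr1 cexpD IHn addn1 exprSr.
case: m => n; first exact: cn.
rewrite NegzE mulrNz mulrN -exprnN -cn.
apply: (mulIf (cexp_neq0 _ (x * n.+1%:R))).
by rewrite -cexpD addNr cexp0 mulVf// cexp_neq0.
Qed.

Lemma cexp_imag (R : realType) (a : R) : cexp (a%:C * 'i%C) = cos a +i* sin a.
Proof.
have -> : a%:C * 'i%C = 0 +i* a by simpc.
by rewrite /cexp expR0 mul1r.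
Qed.

Lemma cexp_Npi (R : realType) : cexp ((- pi)%:C * 'i%C) = -1 :> R[i].
Proof. by rewrite cexp_imag cosN sinN cospi sinpi; simpc. Qed.

Lemma cexp_pi2 (R : realType) : cexp ((pi / 2)%:C * 'i%C) = 'i%C :> R[i].
Proof. by rewrite cexp_imag cos_pihalf sin_pihalf. Qed.

Lemma normr_cexp (R : realType) (x : R[i]) :
  `|cexp x| = (expR (complex.Re x))%:C.
Proof.
rewrite /cexp normrM !normc_def /= cos2Dsin2 sqrtr1 expr0n /= addr0 sqrtr_sqr.
by rewrite ger0_norm ?expR_ge0// mulr1.
Qed.

Lemma normr_epow (R : realType) (w : R[i]) (s : R) :
  `|epow w s| = (expR (- (2 * pi * s * complex.Im w)))%:C.
Proof.
rewrite /epow normr_cexp; case: w => a b; congr (expR _)%:C; simpc => /=; ring.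
Qed.

(** * The summands of the two series, and the quadratic form in their moduli *)

Lemma g4_term_Fstar_term (R : realType) (tau z1 z2 z3 : R[i])
    (a b c n1 n2 n3 : int) :
  let Y1 : R := 3 * a%:~R in let Y2 : R := 3 * b%:~R in
  let Y3 : R := 3 * c%:~R in
  let w1 : R[i] :=
    3 * (z1 + z2 - z3) - (Y1 + Y2 + Y3)%:C * tau - 3 * tau / 2 + 2^-1 in
  let w2 : R[i] := 3 * z1 - (Y1 + Y3)%:C * tau in
  let w3 : R[i] := 3 * z2 - (Y2 + Y3)%:C * tau in
  g4_term z1 z2 z3 tau (n1, n2, n3) =
    'i%C
      * epow tau (3^-1 * (Y1 * Y2 + Y1 * Y3 + Y2 * Y3) + Y3 ^+ 2 / 6 + Y3 / 2
                  - 3 / 8)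
      * epow z1 (- Y2 - Y3) * epow z2 (- Y1 - Y3) * epow z3 (Y3 - 3 / 2)
      * (epow (3 * tau) (- 8^-1) * epow w1 (- 2^-1) * epow w2 2^-1
         * epow w3 2^-1)
      * Fstar_term w1 w2 w3 (3 * tau) (n3 + c, n2 - n3 + b, n1 - n3 + a).
Proof.
move=> Y1 Y2 Y3 w1 w2 w3; rewrite /Fstar_term /g4_term.
(* The signs become exponentials: (-1)^m as e^(-pi i m) and i as e^(pi i/2). They cancel exactly
   against the shift 1/2 in [w1], raised to the powers m and -1/2; choosing e^(pi i) for -1 would
   leave a stray e^(2 pi i m). Both sides are then one [cexp], with exponents equal as rational
   expressions in which pi is an indeterminate. *)
rewrite -[in RHS]cexp_Npi -cexpMz.
rewrite -[X in X * epow tau _ * epow z1 (- Y2 - Y3)]cexp_pi2.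
rewrite /epow -!cexpD; congr cexp; rewrite /w1 /w2 /w3 /Y1 /Y2 /Y3.
move: (pi : R) => p.
by field.
Qed.

(** Completing the square in n absorbs the moduli of the zeta powers into x = n + y/v, leaving the
    first exponential, free of n. *)
Lemma normr_g4_term (R : realType) (tau z1 z2 z3 : R[i]) (n : Z3) :
  let v : R := complex.Im tau in
  let y1 : R := complex.Im z1 in let y2 : R := complex.Im z2 in
  let y3 : R := complex.Im z3 in
  let: (x1, x2, x3) := shifted z1 z2 z3 tau n in
  v != 0 ->
  `|g4_term z1 z2 z3 tau n| =
    (expR (6 * pi * (y1 * y2 - y3 ^+ 2 / 2) / v)
     * expR (- (6 * pi * v * (x1 * x2 - x3 ^+ 2 / 2))))%:C.
Proof.
case: n => [[n1 n2] n3] v y1 y2 y3; rewrite /shifted /g4_term => v0.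
rewrite 3!normrM
  !normr_epow -!rmorphM -!expRD; congr (expR _)%:C.
rewrite -/v -/y1 -/y2 -/y3; move: (pi : R) => p.
by field.
Qed.

(** The form equals t^2/2 + t(s1 + s2) + s1 s2. In either sign case t^2/2 >= d|t|/2, t(s1 + s2) >=
    d(|s1| + |s2|) and s1 s2 >= 0. *)
Lemma quadratic_form_ge (R : realFieldType) (d t s1 s2 : R) : 0 <= d ->
  [/\ d <= t, d <= s1 & d <= s2] \/ [/\ t <= - d, s1 <= - d & s2 <= - d] ->
  d / 2 * (`|t| + `|s1| + `|s2|) <= (s1 + t) * (s2 + t) - t ^+ 2 / 2.
Proof.
move=> d0 [] [ht hs1 hs2].
  rewrite !ger0_norm ?(le_trans d0)//; nra.
have d0' : - d <= 0 by rewrite oppr_le0.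
rewrite !ler0_norm ?(le_trans _ d0')//; nra.
Qed.

(** * Integers shifted by a fractional part *)

Lemma frac_div_itv (R : realType) (v x : R) : v != 0 -> ~ in_Zmul v x ->
  0 < x / v - (Num.floor (x / v))%:~R < 1.
Proof.
move=> v0 xv; apply/andP; split; last first.
  by rewrite ltrBlDl -[X in _ + X]/(1%:~R) -intrD floorD1_gt.
rewrite subr_gt0 lt_neqAle floor_le andbT; apply/eqP => e.
by apply: xv; exists (Num.floor (x / v)); rewrite e mulfVK.
Qed.

(** This turns the real inequalities defining the cones into sign conditions on integers; since m +
    f never vanishes, it serves strict and weak inequalities alike. *)
Lemma intr_frac_ge0 (R : realDomainType) (f : R) (m : int) : 0 < f < 1 ->
  (0 <= m%:~R + f) = (0 <= m).
Proof.
move=> /andP[f0 f1]; case: m => n; first by rewrite addr_ge0// ltW.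
rewrite NegzE mulrNz leNgt addrC subr_lt0 (lt_le_trans f1)//.
by rewrite -[X in X <= _]/(1%:R) ler_nat.
Qed.

(** The first two clauses supply the distance from 0 for the quadratic form; the third trades |m +
    f| for |m| at the cost of 1, so that the final bound has integer exponents. *)
Lemma intr_frac_far (R : realFieldType) (f d : R) (m : int) :
  0 < f < 1 -> d <= f -> d <= 1 - f ->
  [/\ 0 <= m -> d <= m%:~R + f, m < 0 -> m%:~R + f <= - d
    & `|m|%N%:R - 1 <= `|m%:~R + f|].
Proof.
move=> /andP[f0 f1] df d1f; have mE : `|m|%N%:R = `|m%:~R| :> R.
  by rewrite natr_absz intr_norm.
split.
- by move=> m0; rewrite (le_trans df)// lerDr ler0z.
(* Integrality gives m <= -1, whence m + f <= f - 1 <= -d. *)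
- rewrite -lezD1 -(ler_int R) intrD => m1; lra.
- rewrite mE lerBlDr -{1}[m%:~R](addrK f) (le_trans (ler_normB _ _))// lerD2l.
  by rewrite ger0_norm ltW.
Qed.

(** * Summation over Z^3 and the passage from cones to octants *)

Lemma summable_on_geometric (R : realType) (B : set Z3) (f : Z3 -> R[i])
    (K r : R) :
  0 <= K -> 0 < r < 1 ->
  (forall n, B n ->
    `|f n| <= (K * (r ^+ `|n.1.1|%N * r ^+ `|n.1.2|%N * r ^+ `|n.2|%N))%:C) ->
  summable_on B f.
Proof.
move=> K0 r01 fB; have [M hM] := @partial_sum_geometric_int_le R r r01.
have r0 n : 0 <= r ^+ n by rewrite exprn_ge0//; case/andP: r01 => /ltW.
pose g (n : Z3) := r ^+ `|n.1.1|%N * r ^+ `|n.1.2|%N * r ^+ `|n.2|%N.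
have gM A : partial_sum g A <= M * M * M.
  apply: (@partial_sum_prod_le _ (int * int)%type int
    (fun p => r ^+ `|p.1|%N * r ^+ `|p.2|%N) (fun n => r ^+ `|n|%N)) => //.
  - by move=> i; exact: mulr_ge0.
  - exact: (@partial_sum_prod_le _ int int (fun n => r ^+ `|n|%N)
      (fun n => r ^+ `|n|%N)).
apply: (@complex_dominated_partial_sum_cvg _ _ _ (fun n => K * g n)
  (K * (M * M * M))).
  move=> n; rewrite /on_set; case: ifPn => [/set_mem/fB//|_].
  by rewrite normr0 ler0c mulr_ge0// /g !mulr_ge0.
by move=> A; rewrite partial_sumE -mulr_sumr -partial_sumE ler_wpM2l.
Qed.

(** The slots correspond to t, s2, s1 in this order: the second variable [w2] of F^* is built from
    [z1], whose exponent in g_4 is 3 n2. *)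
Definition to_octant (a b c : int) (n : Z3) : Z3 :=
  (n.2 + c, n.1.2 - n.2 + b, n.1.1 - n.2 + a).

Definition of_octant (a b c : int) (m : Z3) : Z3 :=
  (m.1.1 + m.2 - c - a, m.1.1 + m.1.2 - c - b, m.1.1 - c).

Lemma to_octantK (a b c : int) : cancel (to_octant a b c) (of_octant a b c).
Proof.
case=> [[n1 n2] n3]; rewrite /to_octant /of_octant /=.
by congr (_, _, _); ring.
Qed.

Lemma of_octantK (a b c : int) : cancel (of_octant a b c) (to_octant a b c).
Proof.
case=> [[n1 n2] n3]; rewrite /to_octant /of_octant /=.
by congr (_, _, _); ring.
Qed.

Section octants.
Variables (R : realType) (tau z1 z2 z3 : R[i]) (a b c : int).
Let v := complex.Im tau.
Let f1 := (complex.Im z1 - complex.Im z3) / v - a%:~R.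
Let f2 := (complex.Im z2 - complex.Im z3) / v - b%:~R.
Let f3 := complex.Im z3 / v - c%:~R.
Hypotheses (f1_itv : 0 < f1 < 1) (f2_itv : 0 < f2 < 1) (f3_itv : 0 < f3 < 1).

Let shiftedE (n1 n2 n3 : int) : shifted z1 z2 z3 tau (n1, n2, n3) =
  ((n1 - n3 + a)%:~R + f1 + ((n3 + c)%:~R + f3),
   (n2 - n3 + b)%:~R + f2 + ((n3 + c)%:~R + f3), (n3 + c)%:~R + f3).
Proof.
rewrite /shifted /f1 /f2 /f3 -/v !intrD !rmorphN /= !mulrBl.
by congr (_, _, _); ring.
Qed.

Lemma g4_pos_octant (n : Z3) :
  g4_pos z1 z2 z3 tau n <-> octant_nonneg (to_octant a b c n).
Proof.
case: n => [[n1 n2] n3]; rewrite /g4_pos /mkset shiftedE /S1 /octant_nonneg /=.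
rewrite !lerDr !intr_frac_ge0//.
by split=> -[].
Qed.

Lemma g4_neg_octant (n : Z3) :
  g4_neg z1 z2 z3 tau n <-> octant_neg (to_octant a b c n).
Proof.
case: n => [[n1 n2] n3].
rewrite /g4_neg /mkset shiftedE /oppS3 /S3 /octant_neg /=.
(* Each m < 0 is rewritten as the negation of 0 <= m, hence of 0 <= m + f, which gives m + f < 0. *)
rewrite !ltNge -(intr_frac_ge0 _ _ (n1 - n3 + a) f1_itv).
rewrite -(intr_frac_ge0 _ _ (n2 - n3 + b) f2_itv).
rewrite -(intr_frac_ge0 _ _ (n3 + c) f3_itv) -!ltNge.
set s1 := _ + f1; set s2 := _ + f2; set t := _ + f3.
split=> [[[[x1 x2] x3] /= [h1 h2 h3] [e1 e2 e3]]|[h3 h2 h1]].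
  by split; lra.
(* [oppS3] is an image under negation, so the preimage is -x. *)
exists (- (s1 + t), - (s2 + t), - t); last by rewrite /= !opprK.
by split; lra.
Qed.

Lemma g4_term_bound : 0 < v -> exists K r, [/\ 0 <= K, 0 < r < 1 &
  forall n, let m := to_octant a b c n in octant_nonneg m \/ octant_neg m ->
    `|g4_term z1 z2 z3 tau n|
      <= (K * (r ^+ `|m.1.1|%N * r ^+ `|m.1.2|%N * r ^+ `|m.2|%N))%:C].
Proof.
move=> v0.
have [d [d0 d1 d2 d3]] : exists d, [/\ 0 < d, d <= f1 /\ d <= 1 - f1,
    d <= f2 /\ d <= 1 - f2 & d <= f3 /\ d <= 1 - f3].
  (* [d] is the least distance of the three fractional parts to 0 and 1, capped at 1. *)
  exists (\big[Num.min/1]_(x <- [:: f1; 1 - f1; f2; 1 - f2; f3; 1 - f3]) x).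
  rewrite !big_cons big_nil; split; rewrite ?lt_min ?ge_min ?lexx ?orbT//.
  move: f1_itv f2_itv f3_itv => /andP[? ?] /andP[? ?] /andP[? ?].
  by repeat (apply/andP; split); lra.
(* The rate is the factor 6 pi v of the modulus times the d/2 of the quadratic bound. The extra 3e
   in the constant below pays for the unit lost in each of the three estimates |m| - 1 <= |m +
   f|. *)
pose e : R := 3 * pi * v * d.
have e0 : 0 < e by rewrite !mulr_gt0// pi_gt0.
pose K0 : R :=
  6 * pi * (complex.Im z1 * complex.Im z2 - complex.Im z3 ^+ 2 / 2) / v.
exists (expR (K0 + 3 * e)), (expR (- e)); split; first exact: expR_ge0.
  by rewrite expR_gt0 expR_lt1 oppr_lt0.
case=> [[n1 n2] n3] m mO; have := @normr_g4_term R tau z1 z2 z3 (n1, n2, n3).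
rewrite shiftedE => -> //; last by rewrite gt_eqF.
rewrite lecR -!expRM_natl -!expRD ler_expR /m /=.
set m1 := n3 + c; set m2 := n2 - n3 + b; set m3 := n1 - n3 + a.
have [p3 q3 r3] := intr_frac_far _ _ _ m1 f3_itv d3.1 d3.2.
have [p2 q2 r2] := intr_frac_far _ _ _ m2 f2_itv d2.1 d2.2.
have [p1 q1 r1] := intr_frac_far _ _ _ m3 f1_itv d1.1 d1.2.
have Q : d / 2 * (`|m1%:~R + f3| + `|m3%:~R + f1| + `|m2%:~R + f2|) <=
    (m3%:~R + f1 + (m1%:~R + f3)) * (m2%:~R + f2 + (m1%:~R + f3))
    - (m1%:~R + f3) ^+ 2 / 2.
  apply: quadratic_form_ge; first exact: ltW.
  by case: mO => [[h1 h2 h3]|[h1 h2 h3]]; [left|right]; split; auto.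
rewrite -/v -/K0.
have pv0 : 0 <= 6 * pi * v by rewrite !mulr_ge0 ?pi_ge0// ltW.
have := ler_wpM2l pv0 Q.
have -> : forall x, 6 * pi * v * (d / 2 * x) = e * x.
  by move=> x; rewrite /e; field.
have := ler_wpM2l (ltW e0) (lerD (lerD r3 r1) r2).
by lra.
Qed.

End octants.

(** * Transport of summability and of the sums between the two series *)

Theorem proposition7p2 (R : realType) (tau z1 z2 z3 : R[i])
    (htau : 0 < complex.Im tau)
    (h3 : ~ in_Zmul (complex.Im tau) (complex.Im z3))
    (h13 : ~ in_Zmul (complex.Im tau) (complex.Im z1 - complex.Im z3))
    (h23 : ~ in_Zmul (complex.Im tau) (complex.Im z2 - complex.Im z3)) :
  let v : R := complex.Im tau in
  let Y1 : R := 3 * (Num.floor ((complex.Im z1 - complex.Im z3) / v))%:~R in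
  let Y2 : R := 3 * (Num.floor ((complex.Im z2 - complex.Im z3) / v))%:~R in
  let Y3 : R := 3 * (Num.floor (complex.Im z3 / v))%:~R in
  let w1 : R[i] :=
    3 * (z1 + z2 - z3) - (Y1 + Y2 + Y3)%:C * tau - 3 * tau / 2 + 2^-1 in
  let w2 : R[i] := 3 * z1 - (Y1 + Y3)%:C * tau in
  let w3 : R[i] := 3 * z2 - (Y2 + Y3)%:C * tau in
  [/\ g4_summable z1 z2 z3 tau,
      Fstar_summable w1 w2 w3 (3 * tau)
    & g4 z1 z2 z3 tau =
      'i%C
      * epow tau (3^-1 * (Y1 * Y2 + Y1 * Y3 + Y2 * Y3) + Y3 ^+ 2 / 6 + Y3 / 2
                  - 3 / 8)
      * epow z1 (- Y2 - Y3) * epow z2 (- Y1 - Y3) * epow z3 (Y3 - 3 / 2)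
      * Fstar w1 w2 w3 (3 * tau)].
Proof.
move=> v Y1 Y2 Y3 w1 w2 w3.
have v_neq0 : v != 0 by rewrite gt_eqF.
have f1_itv := frac_div_itv _ _ _ v_neq0 h13.
have f2_itv := frac_div_itv _ _ _ v_neq0 h23.
have f3_itv := frac_div_itv _ _ _ v_neq0 h3.
move: f1_itv f2_itv f3_itv @Y1 @Y2 @Y3 @w1 @w2 @w3.
set a := Num.floor (_ / v); set b := Num.floor (_ / v).
set c := Num.floor (_ / v).
move=> f1_itv f2_itv f3_itv Y1 Y2 Y3 w1 w2 w3.
have term n := g4_term_Fstar_term R tau z1 z2 z3 a b c n.1.1 n.1.2 n.2.
rewrite /= -/Y1 -/Y2 -/Y3 -/w1 -/w2 -/w3 in term.
rewrite /Fstar mulrA.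
set k := (X in _ = X * (sum_on _ _ + _)).
have {}term n : g4_term z1 z2 z3 tau n =
    k * Fstar_term w1 w2 w3 (3 * tau) (to_octant a b c n).
  by case: n => [[n1 n2] n3]; exact: (term (n1, n2, n3)).
(* As a product of exponentials, i included, [k] is invertible; this lets the bound on the g_4
   summands pass back to F^*. *)
have k_neq0 : k != 0.
  rewrite /k -[X in X * epow tau _]cexp_pi2 /epow -!cexpD; exact: cexp_neq0.
have [K [r [K0 r01 bound]]] :=
  g4_term_bound _ _ _ _ _ _ _ _ f1_itv f2_itv f3_itv htau.
(* The geometric bound is known for g_4: it is read in octant coordinates through [of_octant], then
   divided by [k], which is a reindexing by the identity with constant [k^-1]. *)
have Fsum B : (forall m, B m -> octant_nonneg m \/ octant_neg m) ->
    summable_on B (Fstar_term w1 w2 w3 (3 * tau)).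
  move=> BO; have gB : summable_on B (g4_term z1 z2 z3 tau \o of_octant a b c).
    apply: (summable_on_geometric _ _ _ K r) => // m Bm.
    by have := bound (of_octant a b c m); rewrite of_octantK; apply; exact: BO.
  apply: (proj1 (sum_on_reindex _ B B _ _ id id k^-1 _ _ _ _ gB)) => // m.
  by rewrite /comp term of_octantK mulKf.
have Fpos : summable_on octant_nonneg (Fstar_term w1 w2 w3 (3 * tau)).
  by apply: Fsum; left.
have Fneg : summable_on octant_neg (Fstar_term w1 w2 w3 (3 * tau)).
  by apply: Fsum; right.
(* Summability of F^* now returns to each cone of g_4 along [to_octant], together with the equality
   of sums up to [k]. *)
have [gpos gposE] := sum_on_reindex _ _ _ _ _ _ _ _ (to_octantK a b c)
  (of_octantK a b c) (g4_pos_octant _ _ _ _ _ _ _ _ f1_itv f2_itv f3_itv)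
  term Fpos.
have [gneg gnegE] := sum_on_reindex _ _ _ _ _ _ _ _ (to_octantK a b c)
  (of_octantK a b c) (g4_neg_octant _ _ _ _ _ _ _ _ f1_itv f2_itv f3_itv)
  term Fneg.
by split=> //; rewrite /g4 gposE gnegE mulrDr.
Qed.
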